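(* Let $\mathbb{K}$ be a field, let $G$ be a connected finite simple graph on the vertex set $[n]=\{1,\ldots,n\}$, let $S=\mathbb{K}[x_1,\ldots,x_n]$, let $\mathfrak{m}=(x_1,\ldots,x_n)$, and let $I=I(G)\subset S$ be the edge ideal of $G$. Suppose that $G$ contains an odd cycle, and let $$k=\min\{j : G \text{ has an odd cycle of length } 2j+1\}.$$ Then $\operatorname{Ass}^{\infty}(I)=\operatorname{Min}(I)\cup\{\mathfrak{m}\}$ if and only if, for every odd cycle $C$ of $G$, we have $V(C)\cup N(C)=[n]$. Moreover, if this condition holds, then $\operatorname{Ass}(I^m)=\operatorname{Min}(I)$ for all integers $1\le m\leq k$ and $\operatorname{Ass}(I^m)=\operatorname{Min}(I)\cup\{\mathfrak{m}\}$ for all integers $m\geq k+1$.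
   Context: The edge ideal of a finite simple graph $G$ on $[n]$ is $I(G)=(x_ix_j : \{i,j\}\text{ is an edge of }G)\subset S$. A cycle of $G$ is a closed walk $C=(\{i_0,i_1\},\{i_1,i_2\},\ldots,\{i_{r-1},i_0\})$ along edges of $G$ with $i_0,\ldots,i_{r-1}$ pairwise distinct (it is not required to be an induced subgraph); its length is $r$, it is odd if $r$ is odd, and $V(C)=\{i_0,\ldots,i_{r-1}\}$. For $A\subset[n]$, $N(A)$ is the set of all vertices of $G$ adjacent to some vertex of $A$, and $N(C)$ means $N(V(C))$. For a monomial ideal $I\subset S$, $\operatorname{Ass}(I^m)$ denotes the set of associated prime ideals of $S/I^m$ and $\operatorname{Min}(I)$ the set of minimal prime ideals of $I$. A monomial prime ideal $P\supseteq I$ is called a persistent prime of $I$ if, whenever $P\in\operatorname{Ass}(I^k)$ for some $k\ge 1$, then $P\in\operatorname{Ass}(I^{k+1})$. $\operatorname{Ass}^{\infty}(I)$ denotes the set of monomial persistent prime ideals $P$ of $I$ with $P\in\bigcup_{k\geq1}\operatorname{Ass}(I^k)$. *)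

(* Defs.v *)
From mathcomp Require Import all_boot all_order all_algebra.
From mathcomp Require Import boolp classical_sets.
From mathcomp Require Import mpoly.

Set Implicit Arguments.
Unset Strict Implicit.
Unset Printing Implicit Defensive.

Import GRing.Theory.

Local Open Scope ring_scope.
Local Open Scope classical_set_scope.

(* Unlike the library's [idealr_closed], this allows the unit ideal. *)
Definition ideal (R : comNzRingType) (J : set R) : Prop :=
  J 0 /\ forall a u v : R, J u -> J v -> J (a * u + v).

Definition ideal_gen (R : comNzRingType) (A : set R) : set R :=
  smallest (@ideal R) A.

Definition ideal_mul (R : comNzRingType) (I J : set R) : set R :=
  ideal_gen [set u * v | u in I & v in J].

(* The zeroth power is the unit ideal. *)
Definition ideal_pow (R : comNzRingType) (I : set R) (m : nat) : set R :=
  iter m (ideal_mul I) setT.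

(* [idealr_closed] includes properness. *)
Definition prime_ideal (R : comNzRingType) (P : set R) : Prop :=
  idealr_closed (mem P) /\ prime_idealr_closed (mem P).

(* The associated primes of the module R / J: the right-hand side of the
   equation is the annihilator of the class of [f] in R / J. *)
Definition Ass (R : comNzRingType) (J : set R) : set (set R) :=
  [set P | prime_ideal P /\ exists f : R, P = [set g | J (g * f)]].

Definition Min (R : comNzRingType) (J : set R) : set (set R) :=
  [set P | [/\ prime_ideal P, J `<=` P &
    forall Q, prime_ideal Q -> J `<=` Q -> Q `<=` P -> Q = P]].

Definition monomial_ideal (K : fieldType) (n : nat)
    (J : set {mpoly K[n]}) : Prop :=
  exists A : set 'X_{1..n}, J = ideal_gen [set 'X_[m] | m in A].

Definition persistent_prime (K : fieldType) (n : nat)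
    (I P : set {mpoly K[n]}) : Prop :=
  [/\ monomial_ideal P, prime_ideal P, I `<=` P &
    forall k : nat, (1 <= k)%N ->
      Ass (ideal_pow I k) P -> Ass (ideal_pow I k.+1) P].

Definition Ass_infty (K : fieldType) (n : nat)
    (I : set {mpoly K[n]}) : set (set {mpoly K[n]}) :=
  [set P | persistent_prime I P /\
    exists2 k : nat, (1 <= k)%N & Ass (ideal_pow I k) P].

Definition max_ideal (K : fieldType) (n : nat) : set {mpoly K[n]} :=
  ideal_gen [set 'X_i | i in [set: 'I_n]].
Arguments max_ideal : clear implicits.

Definition edge_ideal (K : fieldType) (n : nat) (e : rel 'I_n) :
    set {mpoly K[n]} :=
  ideal_gen [set f | exists i j : 'I_n, e i j /\ f = 'X_i * 'X_j].
Arguments edge_ideal K {n} e _.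

(* A cycle is the sequence of its (distinct) vertices.  For an irreflexive
   relation, an odd cycle automatically has at least three vertices. *)
Definition odd_cycle (T : eqType) (e : rel T) (c : seq T) : bool :=
  ucycleb e c && odd (size c).

Definition has_odd_cycle (T : finType) (e : rel T) (j : nat) : bool :=
  [exists c : (2 * j + 1).-tuple T, odd_cycle e c].

Lemma has_odd_cycleP (T : finType) (e : rel T) (j : nat) :
  reflect (exists2 c : seq T, odd_cycle e c & size c = (2 * j + 1)%N)
          (has_odd_cycle e j).
Proof.
apply: (iffP existsP) => [[c ec]|[c ec /eqP sc]].
  by exists c; rewrite ?size_tuple.
by exists (Tuple sc).
Qed.

Lemma ex_has_odd_cycle (T : finType) (e : rel T) :
  (exists c : seq T, odd_cycle e c) -> exists j, has_odd_cycle e j.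
Proof.
case=> c ec; exists (size c)./2; apply/has_odd_cycleP; exists c => //.
by case/andP: ec => _ oc; rewrite -[LHS]odd_double_half oc mul2n addnC.
Qed.

Definition min_odd_cycle (T : finType) (e : rel T)
    (h : exists c : seq T, odd_cycle e c) : nat :=
  ex_minn (ex_has_odd_cycle h).

Definition neighbors (T : finType) (e : rel T) (A : {set T}) : {set T} :=
  [set j | [exists i in A, e i j]]%SET.

Definition odd_cycles_dominating (T : finType) (e : rel T) : Prop :=
  forall c : seq T, odd_cycle e c ->
    ([set:: c] :|: neighbors e [set:: c] = [set: T])%SET.

(* Main.v *)
(* A monomial x^a lies in I^s iff some s edges, taken with repetition, have
   degree vector at most a.  A colon of I^s by a polynomial which is prime is a
   colon by a monomial, so the associated primes of I^s are the P_F = (x_i : i in F)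
   for which some a satisfies: x^(a+b) lies in I^s iff b meets F.

   Let R be the set of vertices of F all of whose neighbours lie in F.  Units of
   a on F minus R can be matched outside F, so one may assume that a vanishes
   there, and then every unit vector of R augments the maximal matching of a
   inside R.  Starting from an exposed vertex of R, the exchange property of edge
   multisets produces a closed alternating walk of odd length less than 2s,
   hence an odd cycle in R.  If all odd cycles dominate, this forces R to be
   empty (P_F is then minimal) or F to be everything (and then k < s).

   Conversely, for an odd cycle C the vector 1_C + 1_L works, where L is a
   maximal independent set away from V(C) and N(C), and F is the complement of L;
   if l lies outside F and y is a neighbour of l, multiplying a witness by
   x_l x_y gives one for the next power, so P_F is persistent. *)
Require Import Defs.
From mathcomp Require Import all_boot all_order all_algebra.
From mathcomp Require Import boolp classical_sets.
From mathcomp Require Import mpoly zify ring.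

Set Implicit Arguments.
Unset Strict Implicit.
Unset Printing Implicit Defensive.

(** * Odd closed walks and odd cycles *)

Section OddWalks.

Variables (T : eqType) (e : rel T).

Definition odd_walk (l : nat) (u w : T) : Prop :=
  exists p, [/\ path e u p, last u p = w, odd (size p) & size p <= l].

Lemma odd_walk_sym l u w : ssrbool.symmetric e -> odd_walk l u w -> odd_walk l w u.
Proof.
move=> e_sym [p [pp lp op sp]]; exists (rev (belast u p)).
rewrite size_rev size_belast op sp; split=> //.
  rewrite -lp rev_path; apply: sub_path pp => x y /=; by rewrite e_sym.
by case: p {pp op sp} lp => [|y p] //= _; rewrite rev_cons last_rcons.
Qed.

Lemma non_uniq_split (s : seq T) :
  ~~ uniq s -> exists x s1 s2 s3, s = s1 ++ x :: s2 ++ x :: s3.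
Proof.
elim: s => [|x s IH] //=; rewrite negb_and negbK => /orP[xs|/IH].
  by case/splitPr: xs => s2 s3; exists x, [::], s2, s3.
by case=> y [s1 [s2 [s3 ->]]]; exists y, (x :: s1), s2, s3.
Qed.

(** A repeated vertex cuts the closed walk into two shorter ones whose lengths add up to an odd
    number, so the induction continues with the odd one. *)
Lemma odd_cycle_of_cycle c : cycle e c -> odd (size c) ->
  exists2 c', odd_cycle e c' & size c' <= size c.
Proof.
have [m] := ubnP (size c); elim: m c => // m IH c lt_c cc oc.
have [uc|/non_uniq_split] := boolP (uniq c).
  by exists c => //; rewrite /odd_cycle /ucycleb cc uc oc.
case=> x [s1 [s2 [s3 dc]]].
(* Started at the first [x], the walk is the loop [x :: s2] followed by the loop
   [x :: (s3 ++ s1)]. *)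
have: cycle e (rot (size s1) c) by rewrite rot_cycle.
rewrite {1}dc rot_size_cat /= -catA rcons_cat /= cat_path /= => /and3P[p1 p2 p3].
have sc : size c = size (x :: s2) + size (x :: (s3 ++ s1)).
  by rewrite dc /= !size_cat /= size_cat /=; lia.
have c1 : cycle e (x :: s2) by rewrite /= rcons_path p1 p2.
have [o1|e1] := boolP (odd (size (x :: s2))).
  case: (IH _ _ c1 o1) => [|c' oc' sc']; first by move: sc lt_c => /=; lia.
  by exists c' => //; apply: leq_trans sc' _; rewrite sc leq_addr.
have o2 : odd (size (x :: (s3 ++ s1))) by move: oc; rewrite sc oddD (negbTE e1).
case: (IH (x :: (s3 ++ s1)) _ p3 o2) => [|c' oc' sc'].
  by move: sc lt_c => /=; lia.
by exists c' => //; apply: leq_trans sc' _; rewrite sc leq_addl.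
Qed.

Lemma odd_cycle_of_walk l u : odd_walk l u u ->
  exists2 c, odd_cycle e c & size c <= l.
Proof.
case=> p; case/lastP: p => [|p x] [pp] //; rewrite last_rcons => xu.
rewrite {x}xu size_rcons in pp * => op sp.
have [c' oc' sc'] := @odd_cycle_of_cycle (u :: p) pp op.
by exists c' => //; apply: leq_trans sc' sp.
Qed.

End OddWalks.

Lemma sub_odd_cycle (T : eqType) (e e' : rel T) (c : seq T) :
  subrel e e' -> odd_cycle e c -> odd_cycle e' c.
Proof.
by move=> ee' /andP[/andP[/(sub_cycle ee') cc uc] oc]; apply/andP; split; first apply/andP.
Qed.

(** * Degree vectors of edge multisets and their exchange property *)

Section EdgeSums.

Variable n : nat.
Implicit Types (e : rel 'I_n) (a b d : 'X_{1..n}) (F : {set 'I_n}).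

Fixpoint edge_sum e (p : nat) d : Prop :=
  if p is q.+1 then
    exists i j d', [/\ e i j, edge_sum e q d' & d = (d' + U_(i) + U_(j))%MM]
  else d = 0%MM.

(** In algebraic terms, x^a lies in the [p]-th power of the edge ideal. *)
Definition edge_bounded e (p : nat) a : Prop :=
  exists2 d, edge_sum e p d & forall x, d x <= a x.

Lemma edge_sum_mdeg e p d : edge_sum e p d -> mdeg d = p.*2.
Proof.
elim: p d => [|p IH] d /=; first by move=> ->; rewrite mdeg0.
by case=> i [j [d' [_ /IH dd ->]]]; rewrite !mdegD !mdeg1 dd doubleS; lia.
Qed.

Lemma edge_sumS e p d i j :
  e i j -> edge_sum e p d -> edge_sum e p.+1 (d + U_(i) + U_(j))%MM.
Proof. by move=> eij sd; exists i, j, d. Qed.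

Lemma edge_sumD e p q d d' :
  edge_sum e p d -> edge_sum e q d' -> edge_sum e (p + q) (d + d')%MM.
Proof.
move=> sd; elim: q d' => [|q IH] d' /=; first by move=> ->; rewrite addn0 addm0.
case=> i [j [d1 [eij /IH s1 ->]]]; rewrite addnS.
by rewrite !addmA; apply: edge_sumS.
Qed.

Lemma edge_sum_remove e p d v : ssrbool.symmetric e -> edge_sum e p d -> 0 < d v ->
  exists w q d', [/\ e v w, p = q.+1, edge_sum e q d' & d = (d' + U_(v) + U_(w))%MM].
Proof.
move=> e_sym; elim: p d => [|p IH] d /=; first by move=> ->; rewrite mnm0E.
case=> i [j [d1 [eij s1 ->]]] d_v.
have [iv|iv] := eqVneq i v; first by exists j, p, d1; rewrite -iv.
have [jv|jv] := eqVneq j v.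
  exists i, p, d1; rewrite -jv e_sym; split=> //.
  by apply/mnmP=> x; rewrite !mnmDE; lia.
have d1v : 0 < d1 v.
  by move: d_v; rewrite !mnmDE !mnm1E (negbTE iv) (negbTE jv) !addn0.
have [w [q [d2 [evw pq s2 d12]]]] := IH _ s1 d1v.
exists w, p, (d2 + U_(i) + U_(j))%MM; split=> //.
  by rewrite pq; apply: edge_sumS.
by rewrite d12; apply/mnmP=> x; rewrite !mnmDE; lia.
Qed.

Lemma edge_sum_sub e e' p d :
  (forall i j, e i j -> 0 < d i -> 0 < d j -> e' i j) ->
  edge_sum e p d -> edge_sum e' p d.
Proof.
elim: p d => [|p IH] d //= ee' [i [j [d1 [eij s1 dd]]]].
have di : 0 < d i by rewrite dd !mnmDE mnm1E eqxx; lia.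
have dj : 0 < d j by rewrite dd !mnmDE (mnm1E j) eqxx; lia.
exists i, j, d1; split=> //; first exact: ee'.
apply: IH s1 => k l ekl dk dl; apply: ee' => //; rewrite dd !mnmDE; lia.
Qed.

Lemma edge_sum_support e p d i : ssrbool.symmetric e ->
  edge_sum e p d -> 0 < d i -> exists2 j, e i j & 0 < d j.
Proof.
move=> e_sym sd di.
have [w [q [d' [evw _ _ ->]]]] := edge_sum_remove e_sym sd di.
by exists w => //; rewrite !mnmDE (mnm1E w) eqxx; lia.
Qed.

Lemma edge_bounded_le e p a a' :
  (forall x, a x <= a' x) -> edge_bounded e p a -> edge_bounded e p a'.
Proof. by move=> aa [d sd da]; exists d => // x; apply: leq_trans (da x) _. Qed.

Lemma edge_boundedS e p a i j : e i j ->
  edge_bounded e p a -> edge_bounded e p.+1 (a + U_(i) + U_(j))%MM.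
Proof.
move=> eij [d sd da]; exists (d + U_(i) + U_(j))%MM; first exact: edge_sumS.
by move=> x; rewrite !mnmDE !leq_add2r.
Qed.

(** If the chosen edges use [y], discarding one edge at [y] frees the extra unit; otherwise that
    unit is idle and any edge may be discarded. *)
Lemma edge_bounded_pred e p a y : ssrbool.symmetric e ->
  edge_bounded e p.+1 (a + U_(y))%MM -> edge_bounded e p a.
Proof.
move=> e_sym [d sd da]; have [dy|dy] := posnP (d y).
  case: sd => i [j [d1 [_ s1 dd]]]; exists d1 => // x.
  move: (da x); have := congr1 (fun m : 'X_{1..n} => m x) dd.
  rewrite !mnmDE (mnm1E y); case: eqP => [<-|_]; rewrite ?dy; lia.
have [w [q [d1 [_ [->] s1 dd]]]] := edge_sum_remove e_sym sd dy.
by exists d1 => // x; move: (da x); rewrite dd !mnmDE; lia.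
Qed.

Lemma edge_bounded_mdeg e p a : edge_bounded e p a -> p.*2 <= mdeg a.
Proof.
case=> d /edge_sum_mdeg <- da; rewrite !mdegE; exact: leq_sum.
Qed.

(* The bound by [maxn] says that the two new endpoints have larger degree in
   [d'] than in [d], by at least two if they coincide.  The induction deletes an
   edge [uv] of [d'] and an edge [vw] of [d], and moves an endpoint at [w] of the
   smaller exchange back to [u]. *)
Lemma edge_sum_exchange e p p' d d' : ssrbool.symmetric e -> irreflexive e ->
  edge_sum e p d -> edge_sum e p' d' -> p < p' ->
  exists u w, [/\ edge_sum e p.+1 (d + U_(u) + U_(w))%MM,
    forall x, (d + U_(u) + U_(w))%MM x <= maxn (d x) (d' x)
    & odd_walk e p.*2.+1 u w].
Proof.
move=> e_sym e_irr; elim: p p' d d' => [|p IH] p' d d' sd sd' lt_p.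
  case: p' sd' lt_p => // p' [i [j [d1 [eij s1 ->]]]] _; exists i, j.
  rewrite (sd : d = 0%MM); split; first exact: edge_sumS.
    by move=> x; rewrite !mnmDE mnm0E; lia.
  by exists [:: j]; rewrite /= eij.
(* The larger multiset has the larger total degree. *)
have [u du] : exists u, d u < d' u.
  apply/existsP; apply: contraPT lt_p; rewrite negb_exists => /forallP le_d.
  apply/negP; rewrite -leqNgt -leq_double -(edge_sum_mdeg sd) -(edge_sum_mdeg sd').
  by rewrite !mdegE; apply: leq_sum => i _; rewrite leqNgt.
have [v [q' [d1' [euv pq' s1' dd']]]] :=
  edge_sum_remove e_sym sd' (leq_ltn_trans (leq0n _) du).
have uv : u != v by apply: contraTneq euv => ->; rewrite e_irr.
have [dv|dv] := ltnP (d v) (d' v).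
  exists u, v; split; first exact: edge_sumS.
    move=> x; rewrite !mnmDE !mnm1E.
    have [<-|xu] := eqVneq u x; first by rewrite eq_sym (negbTE uv); lia.
    by have [<-|xv] := eqVneq v x; lia.
  by exists [:: v]; rewrite /= euv.
have dv0 : 0 < d v.
  by apply: leq_trans dv; rewrite dd' !mnmDE (mnm1E v) eqxx; lia.
have [w [q [d1 [evw [pq] s1 dd]]]] := edge_sum_remove e_sym sd dv0.
rewrite -{q}pq in s1.
have lt_pq : p < q' by lia.
have [u' [w' [s2 b2 w2]]] := IH _ _ _ s1 s1' lt_pq.
(* Here [uv] is added in place of [vw], and the walk grows by these two edges, which keeps its
   length odd. *)
have ext w'' : edge_sum e p.+1 (d1 + U_(w) + U_(w''))%MM ->
  (forall x, (d1 + U_(w) + U_(w''))%MM x <= maxn (d1 x) (d1' x)) ->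
  odd_walk e p.*2.+1 w w'' ->
  exists u w, [/\ edge_sum e p.+2 (d + U_(u) + U_(w))%MM,
    forall x, (d + U_(u) + U_(w))%MM x <= maxn (d x) (d' x)
    & odd_walk e (p.+1).*2.+1 u w].
  move=> s3 b3 [z [z1 z2 z3 z4]]; exists u, w''; split.
  - have -> : (d + U_(u) + U_(w'') = d1 + U_(w) + U_(w'') + U_(u) + U_(v))%MM.
      by rewrite dd; apply/mnmP=> x; rewrite !mnmDE; lia.
    exact: edge_sumS.
  - move=> x; move: (b3 x); move: du; rewrite dd dd' !mnmDE !mnm1E.
    by have [<-|xu] := eqVneq u x; lia.
  exists (v :: w :: z); rewrite /= euv evw z1 z2 negbK z3 doubleS.
  by split=> //; lia.
have [u'w|u'w] := eqVneq u' w; first by rewrite u'w in s2 b2 w2; apply: ext s2 b2 w2.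
have [w'w|w'w] := eqVneq w' w.
  have sumC : (d1 + U_(u') + U_(w') = d1 + U_(w) + U_(u'))%MM.
    by rewrite w'w; apply/mnmP=> x; rewrite !mnmDE; lia.
  rewrite sumC in s2 b2; rewrite w'w in w2.
  exact: ext s2 b2 (odd_walk_sym e_sym w2).
(* Neither endpoint is [w], so restoring the edge [vw] respects the bound at [w]; at [v] both degree
   vectors regain one unit. *)
exists u', w'; split.
- have -> : (d + U_(u') + U_(w') = d1 + U_(u') + U_(w') + U_(v) + U_(w))%MM.
    by rewrite dd; apply/mnmP=> x; rewrite !mnmDE; lia.
  exact: edge_sumS.
- move=> x; move: (b2 x); rewrite dd dd' !mnmDE !mnm1E.
  have [xw|xw] := eqVneq w x; last lia.
  by subst x; rewrite (negbTE u'w) (negbTE w'w); lia.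
case: w2 => z [z1 z2 z3 z4]; exists z; split=> //; rewrite doubleS; lia.
Qed.

(** A multiset of [p] edges, exposed at [v], is exchanged against one for [a] plus a unit at [v].
    The result can exceed [a] only when both new endpoints are [v]; since [p] is maximal, the walk
    is closed. *)
Lemma odd_cycle_of_augmentable e p a (R : {set 'I_n}) i0 :
  ssrbool.symmetric e -> irreflexive e -> (forall i j, e i j -> i \in R) ->
  i0 \in R -> edge_bounded e p a -> ~ edge_bounded e p.+1 a ->
  (forall i, i \in R -> edge_bounded e p.+1 (a + U_(i))%MM) ->
  exists2 c, odd_cycle e c & size c <= p.*2.+1.
Proof.
move=> e_sym e_irr eR i0R [d sd da] max_p aug.
(* Without an exposed vertex, [p.+1] edges would have total degree at most 2p+1. *)
have [v /andP[vR dv]] : exists v, (v \in R) && (d v < a v).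
  apply/existsP; apply: contraT; rewrite negb_exists => /forallP eq_d.
  have [d' sd' da'] := aug _ i0R.
  suff: mdeg d' <= mdeg (d + U_(i0))%MM.
    by rewrite mdegD mdeg1 (edge_sum_mdeg sd) (edge_sum_mdeg sd') doubleS; lia.
  rewrite !mdegE; apply: leq_sum => x _.
  have [->|d'x] := posnP (d' x) => //.
  have [y exy _] := edge_sum_support e_sym sd' d'x.
  by move: (eq_d x) (da' x); rewrite (eR _ _ exy) -leqNgt !mnmDE; lia.
have [d' sd' da'] := aug _ vR.
have [u [w [sN bN wk]]] := edge_sum_exchange e_sym e_irr sd sd' (ltnSn p).
have [uw|uw] := eqVneq u w.
  by rewrite uw in wk; apply: odd_cycle_of_walk wk.
case: max_p; exists (d + U_(u) + U_(w))%MM => // x.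
move: (bN x) (da x) (da' x) uw; rewrite !mnmDE !mnm1E.
have [xv|xv] := eqVneq v x; last lia.
by subst x; have [->|_] := eqVneq u v; have [_|_] := eqVneq w v; rewrite ?eqxx; lia.
Qed.

End EdgeSums.

(** * Combinatorics of prime colons *)

Section ColonPrimes.

Variables (n : nat) (e : rel 'I_n).
Hypotheses (e_sym : ssrbool.symmetric e) (e_irr : irreflexive e).
Implicit Types (a b d : 'X_{1..n}) (F : {set 'I_n}).

(** This is membership of x^b in the prime generated by the variables in [F]. *)
Definition touches F b : Prop := exists2 i, i \in F & 0 < b i.

(* [I^s : x^a] is the prime generated by the variables in [F]. *)
Definition colon_prime (s : nat) F a : Prop :=
  forall b, edge_bounded e s (a + b)%MM <-> touches F b.

(** In the second clause, minimality is expressed by a private edge: one that no other vertex of the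
    cover meets. *)
Definition min_cover F : Prop :=
  (forall i j, e i j -> (i \in F) || (j \in F)) /\
  (forall i, i \in F -> exists2 j, e i j & j \notin F).

Definition interior F : {set 'I_n} :=
  [set i in F | [forall j, e i j ==> (j \in F)]].

Lemma min_cover_interior F :
  (forall i j, e i j -> (i \in F) || (j \in F)) -> interior F = finset.set0 ->
  min_cover F.
Proof.
move=> cF R0; split=> // i iF; have := finset.in_set0 i.
rewrite -R0 inE iF /= => /negbT; rewrite negb_forall => /existsP[j].
by rewrite negb_imply => /andP[eij jF]; exists j.
Qed.

(** Dropping the unit at [y] costs at most one edge, and the unit at [l] is invisible to [F];
    conversely, the edge [ly] can be added to any witness. *)
Lemma colon_primeS s F a l y : colon_prime s F a -> l \notin F -> e l y ->
  colon_prime s.+1 F (a + U_(l) + U_(y))%MM.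
Proof.
move=> aF lF ely b; split.
  have -> : (a + U_(l) + U_(y) + b = (a + (U_(l) + b)) + U_(y))%MM.
    by apply/mnmP=> x; rewrite !mnmDE; lia.
  move/(edge_bounded_pred e_sym)/aF => [i iF]; rewrite mnmDE mnm1E.
  have [li|li] := eqVneq l i; first by rewrite li iF in lF.
  by exists i.
move/aF => ab.
have -> : (a + U_(l) + U_(y) + b = a + b + U_(l) + U_(y))%MM.
  by apply/mnmP=> x; rewrite !mnmDE; lia.
exact: edge_boundedS.
Qed.

(** The [s]-th power of an edge missed by [F] would lie in the colon without touching [F]. *)
Lemma colon_prime_cover s F a i j :
  colon_prime s F a -> e i j -> (i \in F) || (j \in F).
Proof.
move=> aF eij; apply: contraT; rewrite negb_or => /andP[iF jF].
have [k] : exists2 k, k \in F & 0 < ((U_(i) + U_(j)) *+ s)%MM k.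
  apply/aF; exists ((U_(i) + U_(j)) *+ s)%MM; last first.
    by move=> x; rewrite mnmDE leq_addl.
  elim: s {aF} => [|s IH]; first by rewrite mulm0n.
  have -> : ((U_(i) + U_(j)) *+ s.+1 = (U_(i) + U_(j)) *+ s + U_(i) + U_(j))%MM.
    by apply/mnmP=> x; rewrite !(mulmnE, mnmDE); lia.
  exact: edge_sumS.
move=> kF; rewrite mulmnE mnmDE !mnm1E.
have [ik|_] := eqVneq i k; first by rewrite ik kF in iF.
by have [jk|_] := eqVneq j k; first by rewrite jk kF in jF.
Qed.

Lemma colon_prime_gt0 s F a : colon_prime s F a -> 0 < s.
Proof.
case: s => // aF; have [|i _] := (aF 0%MM).1; last by rewrite mnm0E.
by exists 0%MM => // x; rewrite mnm0E.
Qed.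

Lemma odd_cycle_in_interior s F a i0 :
  colon_prime s F a -> i0 \in interior F ->
  exists2 c, odd_cycle [rel i j | [&& e i j, i \in interior F & j \in interior F]] c
    & size c < s.*2.
Proof.
set R := interior F; set eR := [rel i j | _] => aF i0R.
have [m] := ubnP (mdeg a); elim: m => // m IH in s a aF *; rewrite ltnS => a_m.
have RF i : i \in R -> i \in F by rewrite inE => /andP[].
have s_gt0 := colon_prime_gt0 aF.
(* A vertex of [F] with a neighbour outside [F] can be matched there, hence it
   only shifts the power by one. *)
have [/existsP[y /andP[/andP[yF yR] ay]]|noY] :=
  boolP [exists y, (y \in F) && (y \notin R) && (0 < a y)].
  have [l eyl lF] : exists2 l, e y l & l \notin F.
    move: yR; rewrite inE yF /= negb_forall => /existsP[l].
    by rewrite negb_imply => /andP[eyl lF]; exists l.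
  have aE : (a = (a - U_(y)) + U_(y))%MM.
    by apply/mnmP=> x; rewrite mnmDE mnmBE mnm1E; case: eqP => [<-|_]; lia.
  have aF' : colon_prime s.-1 F (a - U_(y))%MM.
    move=> b; split.
      move=> /(edge_boundedS eyl).
      have -> : (a - U_(y) + b + U_(y) + U_(l) = a + (U_(l) + b))%MM.
        by rewrite {2}aE; apply/mnmP=> x; rewrite !mnmDE; lia.
      rewrite prednK // => /aF[i iF]; rewrite mnmDE mnm1E.
      have [li|li] := eqVneq l i; first by rewrite li iF in lF.
      by exists i.
    move=> /aF; rewrite {1}aE -{1}(prednK s_gt0).
    have -> : (a - U_(y) + U_(y) + b = a - U_(y) + b + U_(y))%MM.
      by apply/mnmP=> x; rewrite !mnmDE; lia.
    exact: edge_bounded_pred.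
  have [|c oc sc] := IH _ _ aF'; first by move: a_m; rewrite {1}aE mdegD mdeg1; lia.
  by exists c => //; lia.
have aY y : y \in F -> y \notin R -> a y = 0.
  move=> yF yR; apply/eqP; apply: contraNT noY; rewrite -lt0n => ay.
  by apply/existsP; exists y; rewrite yF yR ay.
have eR_sym : ssrbool.symmetric eR by move=> i j /=; rewrite e_sym (andbC (i \in R)).
have eR_irr : irreflexive eR by move=> i /=; rewrite e_irr.
have aug i : i \in R -> edge_bounded eR s (a + U_(i))%MM.
  move=> iR; have [|d sd da] := (aF U_(i)%MM).2.
    by exists i; [exact: RF | rewrite mnm1E eqxx].
  exists d => //.
  have dY y : y \in F -> 0 < d y -> y \in R.
    move=> yF; apply: contraTT => yR; have := da y.
    rewrite mnmDE (aY _ yF yR) mnm1E; case: eqP => [iy|_]; last lia.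
    by rewrite -iy iR in yR.
  (* A used vertex of [F] is interior, so its neighbour lies in [F] and, if used, is interior too.
     As [F] is a cover, the whole witness lives in the interior. *)
  have step j k : e j k -> j \in F -> 0 < d j -> 0 < d k -> (j \in R) && (k \in R).
    move=> ejk jF dj dk; have jR := dY _ jF dj; rewrite jR /= dY //.
    by move: jR; rewrite inE => /andP[_ /forallP/(_ k)]; rewrite ejk.
  apply: edge_sum_sub sd => j k ejk dj dk /=; rewrite ejk /=.
  case/orP: (colon_prime_cover aF ejk) => [jF|kF]; first exact: step.
  by rewrite andbC; apply: step; rewrite // e_sym.
case: s aF s_gt0 {IH} aug => // s aF _ aug.
have [|||||||c oc sc] := @odd_cycle_of_augmentable n eR s a R i0 => //.
- by move=> i j /= /and3P[].
- exact: edge_bounded_pred (aug _ i0R).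
- move=> [d sd da]; have [|i _] := (aF 0%MM).1; last by rewrite mnm0E.
  exists d; last by move=> x; rewrite addm0.
  by apply: edge_sum_sub sd => i j /= /and3P[].
by exists c => //; rewrite doubleS.
Qed.

(** The complement of a cover is independent, so every edge below the vector needs a unit of [b] in
    [F]; conversely, private edges turn such a unit into an edge. *)
Lemma min_cover_colon_prime F : min_cover F ->
  colon_prime 1 F (\sum_(l | l \notin F) U_(l))%MM.
Proof.
move=> [cF mF].
have sumE x : (\sum_(l | l \notin F) U_(l))%MM x = (x \notin F).
  rewrite mnm_sumE; under eq_bigr do rewrite mnm1E.
  rewrite -big_mkcondr /= sum1dep_card.
  have [xF|xF] := boolP (x \in F).
    by apply: eq_card0 => y; rewrite inE; apply/negP=> /andP[yF /eqP yx]; rewrite yx xF in yF.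
  rewrite (@eq_card1 _ x) // => y; rewrite !inE; have [->|] := eqVneq y x; by rewrite ?xF ?andbF.
move=> b; split.
  case=> d [i [j [d0 [eij /= -> ->]]]] db.
  have: exists2 k, k \in F & 0 < (0 + U_(i) + U_(j))%MM k.
    case/orP: (cF _ _ eij) => kF; [exists i | exists j] => //;
    by rewrite !mnmDE mnm0E !mnm1E eqxx; lia.
  by case=> k kF dk; exists k => //; move: (db k) dk; rewrite !mnmDE sumE kF; lia.
case=> i iF bi; have [j eij jF] := mF _ iF.
exists (0 + U_(i) + U_(j))%MM; first by exists i, j, 0%MM.
move=> x; rewrite !mnmDE sumE mnm0E !mnm1E.
have [<-|ix] := eqVneq i x; last by have [<-|_] := eqVneq j x; rewrite ?jF; lia.
by have [ji|] := eqVneq j i; [rewrite ji iF in jF | lia].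
Qed.

Lemma edge_sum_path x p : path e x p -> ~~ odd (size p) ->
  edge_sum e (size p)./2 (\sum_(y <- p) U_(y))%MM.
Proof.
have [m] := ubnP (size p); elim: m => // m IH in x p *.
case: p => [|y [|z p]] //=; first by rewrite big_nil.
rewrite !ltnS negbK => lt_p /and3P[_ eyz pp] op.
rewrite !big_cons.
have -> : (U_(y) + (U_(z) + \sum_(j <- p) U_(j)) = \sum_(j <- p) U_(j) + U_(y) + U_(z))%MM.
  by apply/mnmP=> k; rewrite !mnmDE; lia.
by apply: edge_sumS => //; apply: IH pp op; apply: leq_trans lt_p.
Qed.

(** Without [v] the cycle is a path on an even number of vertices, hence perfectly matched, and [v]
    is matched with the extra unit at [w]. *)
Lemma odd_cycle_bounded c v w : odd_cycle e c -> v \in c -> e v w ->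
  edge_bounded e (size c)./2.+1 (\sum_(y <- c) U_(y) + U_(w))%MM.
Proof.
move=> /andP[/andP[cc uc] oc] vc evw; have [i c' dc] := rot_to vc.
have: cycle e (v :: c') by rewrite -dc rot_cycle.
have sc : size c = (size c').+1 by rewrite -(size_rot i) dc.
rewrite /= rcons_path => /andP[pc _].
have oc' : ~~ odd (size c') by rewrite sc in oc.
exists (\sum_(y <- c') U_(y) + U_(v) + U_(w))%MM.
  have -> : (size c)./2 = (size c')./2 by rewrite sc /= uphalf_half (negbTE oc').
  by apply: edge_sumS => //; apply: edge_sum_path pc oc'.
move=> x; have -> : (\sum_(y <- c) U_(y))%MM = (\sum_(y <- rot i c) U_(y))%MM.
  by apply: perm_big; rewrite perm_sym perm_rot.
by rewrite dc big_cons !mnmDE; lia.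
Qed.

Lemma mdeg_sum_seq (c : seq 'I_n) : mdeg (\sum_(y <- c) U_(y))%MM = size c.
Proof. by rewrite mdeg_sum; under eq_bigr do rewrite mdeg1; rewrite sum1_size. Qed.

Lemma sum_seq_gt0 (c : seq 'I_n) x : (0 < (\sum_(y <- c) U_(y))%MM x) = (x \in c).
Proof.
elim: c => [|y c IH]; first by rewrite big_nil mnm0E.
by rewrite big_cons mnmDE addn_gt0 IH inE mnm1E eq_sym; case: eqP.
Qed.

Lemma odd_cycle_edge c v : odd_cycle e c -> v \in c -> exists2 w, w \in c & e v w.
Proof.
move=> /andP[/andP[cc _] _] vc; exists (next c v); first by rewrite mem_next.
exact: next_cycle.
Qed.

Lemma dominating_colon_prime c s : odd_cycle e c -> c != [::] ->
  ([set:: c] :|: neighbors e [set:: c] = [set: 'I_n])%SET ->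
  (size c)./2 < s -> exists a, colon_prime s [set: 'I_n]%SET a.
Proof.
move=> oc c0 dom lt_s.
(* Monomials of I^s have degree at least 2s, so the degree bound makes every [b] in the colon
   nonzero. *)
suff [a da aug] : exists2 a, mdeg a < s.*2 & forall i, edge_bounded e s (a + U_(i))%MM.
  exists a => b; split=> [/edge_bounded_mdeg|[i _ bi]].
    rewrite mdegD => leb; have : 0 < mdeg b by lia.
    rewrite lt0n mdeg_eq0 => b0; apply: contrapT => nb; move/negP: b0; apply.
    apply/eqP/mnmP=> i; rewrite mnm0E; apply/eqP; rewrite eqn0Ngt.
    by apply/negP=> bi; apply: nb; exists i.
  apply: edge_bounded_le (aug i) => x; rewrite !mnmDE leq_add2l mnm1E.
  by case: eqP => [<-|].
have [v vc] : exists v, v \in c by case: (c) c0 => // v c' _; exists v; rewrite mem_head.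
have [u _ evu] := odd_cycle_edge oc vc.
(* The smallest power takes the indicator of the cycle; each further power multiplies by the edge
   [vu]. *)
elim: s lt_s => // s IH; rewrite ltnS leq_eqVlt => /orP[/eqP<-|/IH[a da aug]].
  exists (\sum_(y <- c) U_(y))%MM.
    by rewrite mdeg_sum_seq doubleS -{1}(odd_double_half (size c)); case: odd; lia.
  move=> i; have: i \in [set: 'I_n]%SET by rewrite finset.in_setT.
  rewrite -dom !inE => /orP[ic|/existsP[w /andP[]]].
    have [w wc eiw] := odd_cycle_edge oc ic.
    by apply: odd_cycle_bounded oc wc _; rewrite e_sym.
  by rewrite inE => wc ewi; apply: odd_cycle_bounded oc wc ewi.
exists (a + U_(v) + U_(u))%MM; first by rewrite !mdegD !mdeg1 doubleS; lia.
move=> i; have -> : (a + U_(v) + U_(u) + U_(i) = a + U_(i) + U_(v) + U_(u))%MM.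
  by apply/mnmP=> x; rewrite !mnmDE; lia.
exact: edge_boundedS.
Qed.

Lemma nondominating_colon_prime c v : odd_cycle e c -> c != [::] ->
  v \notin ([set:: c] :|: neighbors e [set:: c])%SET ->
  exists F a s, [/\ v \notin F, colon_prime s F a & ~ min_cover F].
Proof.
move=> oc c0 vN; set N := (_ :|: _)%SET in vN.
pose P (L : {set 'I_n}) := [disjoint L & N] &&
  [forall i in L, forall j in L, ~~ e i j].
have Pv : P [set v]%SET.
  rewrite /P disjoints1 vN; apply/forall_inP=> i; rewrite inE => /eqP->.
  by apply/forall_inP=> j; rewrite inE => /eqP->; rewrite e_irr.
have [L /maxsetP[/andP[LN /forall_inP Lind] Lmax]] := maxset_exists Pv.
rewrite finset.sub1set => vL.
have {}Lind i j : i \in L -> j \in L -> ~~ e i j by move=> iL jL; move/forall_inP: (Lind i iL) => /(_ j jL).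
have cL i : i \in c -> i \notin L.
  by move=> ic; rewrite (disjointFl LN) // !inE ic.
have cNL i j : i \in c -> e i j -> j \notin L.
  move=> ic eij; rewrite (disjointFl LN) // !inE; apply/orP; right.
  by apply/existsP; exists i; rewrite inE ic.
exists (~: L)%SET, (\sum_(y <- c) U_(y) + \sum_(l in L) U_(l))%MM, (size c)./2.+1.
split; first by rewrite inE vL.
  have sumLE x : (\sum_(l in L) U_(l))%MM x = (x \in L).
    have [xL|xL] := boolP (x \in L).
      rewrite (bigD1 x) //= mnmDE mnm1E eqxx mnm_sumE big1 // => l /andP[_ lx].
      by rewrite mnm1E (negbTE lx).
    rewrite mnm_sumE big1 // => l lL; rewrite mnm1E.
    by case: eqP => // lx; rewrite -lx lL in xL.
  move=> b; split.
    (* If [b] lives on [L], the witness lives on the cycle and [L]. No edge at [L] stays inside this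
       set, so the witness lives on the cycle, whose degree [size c] is one too small. *)
    case=> d sd db; apply: contrapT => nb.
    have bF x : x \notin L -> b x = 0.
      move=> xL; apply/eqP; rewrite eqn0Ngt; apply/negP=> bx.
      by apply: nb; exists x => //; rewrite inE.
    have d_supp x : 0 < d x -> x \in c \/ x \in L.
      move=> dx; have [xL|xL] := boolP (x \in L); [by right | left].
      rewrite -sum_seq_gt0; move: (db x).
      by rewrite !mnmDE sumLE (negbTE xL) (bF _ xL) !addn0; apply: leq_trans.
    have dL x : x \in L -> d x = 0.
      move=> xL; apply/eqP; rewrite eqn0Ngt; apply/negP=> dx.
      have [y exy /d_supp[yc|yL]] := edge_sum_support e_sym sd dx.
        by move: (cNL y x yc); rewrite e_sym xL => /(_ exy).
      by move: (Lind _ _ xL yL); rewrite exy.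
    have: mdeg d <= mdeg (\sum_(y <- c) U_(y))%MM.
      rewrite !mdegE; apply: leq_sum => x _.
      have [xL|xL] := boolP (x \in L); first by rewrite dL.
      by move: (db x); rewrite !mnmDE sumLE (negbTE xL) (bF _ xL); lia.
    rewrite (edge_sum_mdeg sd) mdeg_sum_seq doubleS -{2}(odd_double_half (size c)).
    by case: odd; lia.
  case=> i; rewrite inE => iL bi.
  have le_aug : edge_bounded e (size c)./2.+1 (\sum_(y <- c) U_(y) + U_(i))%MM ->
      edge_bounded e (size c)./2.+1 (\sum_(y <- c) U_(y) + \sum_(l in L) U_(l) + b)%MM.
    apply: edge_bounded_le => x; rewrite !mnmDE mnm1E.
    by case: eqP => [<-|_]; lia.
  have [iN|iN] := boolP (i \in N).
    move: iN; rewrite !inE => /orP[ic|/existsP[w /andP[]]].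
      have [w wc eiw] := odd_cycle_edge oc ic.
      by apply: le_aug; apply: odd_cycle_bounded oc wc _; rewrite e_sym.
    by rewrite inE => wc ewi; apply: le_aug; apply: odd_cycle_bounded oc wc ewi.
  (* Otherwise [i] could be added to [L], against maximality. *)
  have [l lL eil] : exists2 l, l \in L & e i l.
    apply: contrapT => no_l.
    have no i' : i' \in L -> ~~ e i i'.
      by move=> iL'; apply/negP=> eii; apply: no_l; exists i'.
    have : P (i |: L)%SET.
      apply/andP; split.
        rewrite disjoint_subset; apply/fintype.subsetP=> x /finset.setU1P[->|xL].
          by rewrite inE.
        by rewrite inE (disjointFr LN xL).
      apply/forall_inP=> j; rewrite !inE => jL; apply/forall_inP=> k; rewrite !inE.
      case/orP: jL => [/eqP->|jL] /orP[/eqP->|kL]; first by rewrite e_irr.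
      - exact: no.
      - by rewrite e_sym; apply: no.
      - exact: Lind.
    by move/Lmax => /(_ (finset.subsetUr _ _)) LE; move: iL; rewrite -LE !inE eqxx.
  have [w wc] : exists w, w \in c by case: (c) c0 => // w c' _; exists w; rewrite mem_head.
  have [u uc ewu] := odd_cycle_edge oc wc.
  (* The cycle alone supplies [(size c)./2] edges; the last one joins [i] to [l]. *)
  have [|d sd da] := @edge_bounded_pred n e (size c)./2 (\sum_(y <- c) U_(y))%MM u e_sym.
    exact: odd_cycle_bounded oc wc ewu.
  exists (d + U_(i) + U_(l))%MM; first exact: edge_sumS.
  move=> x; move: (da x); rewrite !mnmDE sumLE !mnm1E.
  have [<-|ix] := eqVneq i x.
    have [li|_] := eqVneq l i; first by rewrite -li lL in iL.
    by rewrite (negbTE iL) !addn0 => di; apply: leq_add.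
  have [<-|_] := eqVneq l x => dx; rewrite addn0 -addnA; apply: leq_add => //.
  by rewrite lL leq_addr.
(* All neighbours of a cycle vertex avoid [L], so this vertex of [F] has no private edge. *)
case=> _ mF; have [w wc] : exists w, w \in c.
  by case: (c) c0 => // w c' _; exists w; rewrite mem_head.
have [|j ewj] := mF w; first by rewrite inE cL.
by rewrite inE negbK; apply/negP; apply: cNL ewj.
Qed.

End ColonPrimes.

Local Open Scope ring_scope.
Local Open Scope classical_set_scope.
Import GRing.Theory.

(** * Monomial ideals, primes generated by variables, associated primes *)

Section MonomialIdeals.

Variables (K : fieldType) (n : nat).
Implicit Types (f g h : {mpoly K[n]}) (Q : 'X_{1..n} -> Prop).
Implicit Types (F : {set 'I_n}) (P J : set {mpoly K[n]}).

Definition upclosed Q : Prop := forall a b, Q a -> Q (a + b)%MM.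

(** For upward closed [Q] this is the monomial ideal spanned by the x^a with [Q a]. *)
Definition supported Q : set {mpoly K[n]} :=
  [set f | forall m, m \in msupp f -> Q m].

Lemma ideal_gen_ideal (R : comNzRingType) (A : set R) : ideal (ideal_gen A).
Proof.
split=> [J [[]] //|a u v uA vA J [iJ AJ]].
by apply: iJ.2; [apply: uA | apply: vA].
Qed.

Lemma sub_ideal_gen (R : comNzRingType) (A : set R) : A `<=` ideal_gen A.
Proof. by move=> f Af J [_]; apply. Qed.

Lemma ideal_add (R : comNzRingType) (J : set R) : ideal J ->
  forall u v, J u -> J v -> J (u + v).
Proof. by move=> [_ iJ] u v Ju Jv; rewrite -[u]mul1r; apply: iJ. Qed.

Lemma ideal_mull (R : comNzRingType) (J : set R) : ideal J ->
  forall u v, J v -> J (u * v).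
Proof. by move=> [J0 iJ] u v Jv; rewrite -[_ * _]addr0; apply: iJ. Qed.

Lemma supported_ideal Q : upclosed Q -> ideal (supported Q).
Proof.
move=> upQ; split=> [m|a u v Qu Qv m]; first by rewrite -(mpolyC0 n K) msupp0.
move/msuppD_le; rewrite mem_cat => /orP[/msuppM_le|]; last exact: Qv.
by case/allpairsP=> -[p q] /= [_ /Qu Qq ->]; rewrite addmC; apply: upQ.
Qed.

Lemma supportedX Q a : supported Q 'X_[a] <-> Q a.
Proof.
split=> [Qa|Qa m]; first by apply: Qa; rewrite msuppX inE.
by rewrite msuppX inE => /eqP->.
Qed.

Lemma ideal_gen_supported Q A : upclosed Q -> A `<=` supported Q ->
  (forall a, Q a -> ideal_gen A 'X_[a]) -> ideal_gen A = supported Q.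
Proof.
move=> upQ AQ QA; apply/seteqP; split.
  by apply: smallest_sub => //; apply: supported_ideal.
move=> f Qf; rewrite [f]mpolyE.
have iA := ideal_gen_ideal A.
rewrite big_seq; apply: big_rec => [|m g mf Ag]; first exact: iA.1.
apply: (ideal_add iA) => //; rewrite -mul_mpolyC.
by apply: (ideal_mull iA); apply: QA; apply: Qf.
Qed.

Lemma mulX_supported Q f a : upclosed Q ->
  supported Q (f * 'X_[a]) <-> forall m, m \in msupp f -> Q (a + m)%MM.
Proof.
move=> upQ; split=> [Qfa m mf|Qfa m].
  by apply: Qfa; rewrite (perm_mem (msuppMX f a)) map_f.
by rewrite (perm_mem (msuppMX f a)) => /mapP[m' m'f ->]; apply: Qfa.
Qed.

Lemma touches_up F : upclosed (touches F).
Proof. by move=> a b [i iF ai]; exists i => //; rewrite mnmDE addn_gt0 ai. Qed.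

Definition var_prime F : set {mpoly K[n]} := supported (touches F).

Lemma var_primeX F i : var_prime F 'X_i <-> i \in F.
Proof.
split=> [/supportedX[j jF]|iF]; last first.
  by apply/supportedX; exists i => //; rewrite mnm1E eqxx.
by rewrite mnm1E; case: eqP => // ->.
Qed.

Lemma var_prime_inj F F' : var_prime F = var_prime F' -> F = F'.
Proof.
move=> FF; apply/setP=> i; apply/idP/idP.
  by move/var_primeX; rewrite FF => /var_primeX.
by move/var_primeX; rewrite -FF => /var_primeX.
Qed.

Lemma var_prime_gen F : var_prime F = ideal_gen [set 'X_i | i in [set i | i \in F]].
Proof.
apply/esym/ideal_gen_supported; first exact: touches_up.
  by move=> _ [i /= iF <-]; apply/var_primeX.
move=> a [i iF ai]; have -> : a = (a - U_(i) + U_(i))%MM.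
  by apply/mnmP=> x; rewrite mnmDE mnmBE mnm1E; case: eqP => [<-|_]; lia.
rewrite mpolyXD; apply: (ideal_mull (ideal_gen_ideal _)).
by apply: sub_ideal_gen; exists i.
Qed.

Lemma var_prime_monomial F : monomial_ideal (var_prime F).
Proof.
exists [set U_(i)%MM | i in [set i | i \in F]].
by rewrite var_prime_gen image_comp.
Qed.

Lemma var_prime_setT : var_prime [set: 'I_n]%SET = max_ideal K n.
Proof.
rewrite var_prime_gen /max_ideal; congr (ideal_gen (_ @` _)).
by apply/seteqP; split=> i //= _; rewrite finset.in_setT.
Qed.

Lemma prime_idealP (R : comNzRingType) (P : set R) : prime_ideal P <->
  [/\ ideal P, ~ P 1 & forall u v, P (u * v) -> P u \/ P v].
Proof.
split=> [[[P0 P1 Pi] Pp]|[[P0 Pi] P1 Pp]].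
  split; first split; first by rewrite inE in P0.
  - by move=> a u v Pu Pv; have := Pi a u v; rewrite !inE; apply.
  - by move=> P1'; move: P1; rewrite notin_setE; apply.
  - by move=> u v Puv; have := Pp u v; rewrite !inE => /(_ Puv)/orP[] /set_mem; [left|right].
split.
  split; rewrite ?inE ?notin_setE //; move=> a u v; rewrite !inE; exact: Pi.
by move=> u v; rewrite !inE => /Pp[] ?; apply/orP; [left|right]; rewrite inE.
Qed.

(** Each polynomial splits into terms free of the variables in [F] and a rest in the ideal. If a
    product lies in the ideal, so does the product of the free parts; being free of [F] it vanishes,
    and so does one factor. *)
Lemma var_prime_prime F : prime_ideal (var_prime F).
Proof.
apply/prime_idealP; split; first exact/supported_ideal/touches_up.
  move=> /(_ 0%MM); rewrite -mpolyC1 msupp1 inE eqxx => /(_ isT)[i _].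
  by rewrite mnm0E.
move=> f g fg; apply: contrapT => /not_orP[nf ng].
pose off (b : 'X_{1..n}) := [forall i in F, b i == 0%N].
have offP b : off b <-> ~ touches F b.
  split=> [/forall_inP b0 [i /b0/eqP->] //|nb]; apply/forall_inP=> i iF.
  by rewrite eqn0Ngt; apply/negP=> bi; apply: nb; exists i.
pose part p : {mpoly K[n]} := \sum_(m <- msupp p | off m) p@_m *: 'X_[m].
have msupp_part p m : m \in msupp (part p) -> off m.
  have : supported off (part p).
    rewrite /part; apply: big_ind => [k|u v ou ov k|k ok k'].
    - by rewrite -(mpolyC0 n K) msupp0.
    - by move/msuppD_le; rewrite mem_cat => /orP[/ou|/ov].
    - by move/msuppZ_le; rewrite msuppX inE => /eqP->.
  exact.
have rest p : var_prime F (p - part p).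
  have -> : p - part p = \sum_(m <- msupp p | ~~ off m) p@_m *: 'X_[m].
    by apply/eqP; rewrite subr_eq addrC {1}[p]mpolyE (bigID off).
  apply: big_ind => [|u v|m nm].
  - exact: (supported_ideal (@touches_up F)).1.
  - exact: (ideal_add (supported_ideal (@touches_up F))).
  - rewrite -mul_mpolyC; apply: (ideal_mull (supported_ideal (@touches_up F))).
    by apply/supportedX; apply: contrapT => /offP; apply/negP.
have part0 p : ~ var_prime F p -> part p != 0.
  by move=> np; apply/eqP=> p0; apply: np; have := rest p; rewrite p0 subr0.
suff : part f * part g = 0.
  by move/eqP; rewrite mulf_eq0 (negbTE (part0 _ nf)) (negbTE (part0 _ ng)).
have : var_prime F (part f * part g).
  have iF := supported_ideal (@touches_up F).
  have -> : part f * part g = (- 1) * (part f * (g - part g)) + ((- g) * (f - part f) + f * g).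
    by ring.
  apply: (ideal_add iF); last apply: (ideal_add iF).
  - by apply: (ideal_mull iF); apply: (ideal_mull iF); apply: rest.
  - by apply: (ideal_mull iF); apply: rest.
  - exact: fg.
move=> Ffg; apply/eqP; rewrite -msupp_eq0; apply/eqP.
case E : (msupp _) => [//|m s].
have mfg : m \in msupp (part f * part g) by rewrite E mem_head.
have [i iF mi] := Ffg _ mfg.
case/allpairsP: (msuppM_le mfg) => -[p q] /= [/msupp_part/offP np /msupp_part/offP nq mE].
move: mi; rewrite mE mnmDE addn_gt0 => /orP[pi|qi]; first by case: np; exists i.
by case: nq; exists i.
Qed.

Lemma var_prime_sub F P : ideal P -> (forall i, i \in F -> P 'X_i) -> var_prime F `<=` P.
Proof. by move=> iP FP; rewrite var_prime_gen; apply: smallest_sub => // _ [i /= /FP Pi <-]. Qed.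

Definition unlead f := f - f@_(mlead f) *: 'X_[mlead f].

Lemma msupp_unlead f : msupp (unlead f) =i rem (mlead f) (msupp f).
Proof.
move=> k; rewrite mcoeff_msupp mcoeffB mcoeffZ mcoeffX.
rewrite (mem_rem_uniq _ (msupp_uniq f)) !inE mcoeff_msupp (eq_sym k).
have [<-|_] := eqVneq (mlead f) k; last by rewrite mulr0 subr0.
by rewrite mulr1 subrr eqxx.
Qed.

Lemma size_unlead f : f != 0 -> (size (msupp (unlead f)) < size (msupp f))%N.
Proof.
move=> f0; have sub : {subset msupp (unlead f) <= rem (mlead f) (msupp f)}.
  by move=> k; rewrite msupp_unlead.
apply: leq_ltn_trans (uniq_leq_size (msupp_uniq _) sub) _.
by rewrite size_rem ?mlead_supp // ltn_predL lt0n size_eq0 msupp_eq0.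
Qed.

(* If [lt g] does not kill [f] modulo [J], then dropping the leading term of
   [f] leaves the annihilator unchanged, so [f] was not of minimal length. *)
Lemma Ass_lead_closed Q P : upclosed Q -> Ass (supported Q) P ->
  forall g, P g -> g != 0 -> P 'X_[mlead g].
Proof.
move=> upQ [pP [f Pf]] g Pg g0.
have [iP nP1 Pp] := (prime_idealP P).1 pP.
have iQ := supported_ideal upQ.
have [m] := ubnP (size (msupp f)); elim: m => // m IH in f Pf *; rewrite ltnS => f_m.
have f0 : f != 0.
  by apply/eqP=> f0; apply: nP1; rewrite Pf f0 /= mulr0; apply: iQ.1.
apply: contrapT => nlt.
have lead_in : Q (mlead g + mlead f)%MM.
  have : supported Q (g * f) by rewrite Pf in Pg.
  by apply; rewrite -mleadM //; apply: mlead_supp; rewrite mulf_neq0.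
pose f1 := unlead f.
have size_f1 : (size (msupp f1) < m)%N by apply: leq_trans f_m; apply: size_unlead.
(* As [P] is prime and misses the leading monomial of [g], multiplying [f] by it keeps the
   annihilator; by [lead_in], [f] may then be replaced by its tail. *)
pose f2 := 'X_[mlead g] * f1.
have Pf2 : P = [set h | supported Q (h * f2)].
  have Pg_f h : P h <-> P (h * 'X_[mlead g]).
    split=> [Ph|/Pp[] //]; by rewrite mulrC; apply: (ideal_mull iP).
  have -> : P = [set h | supported Q (h * 'X_[mlead g] * f)].
    by apply/seteqP; split=> h /=; rewrite Pg_f {1}Pf.
  have diff h : supported Q (h * 'X_[mlead g] * (f - f1)).
    rewrite opprB addrC subrK -mulrA -scalerAr -mpolyXD -mul_mpolyC mulrCA.
    by do 2! (apply: (ideal_mull iQ) => //); apply/supportedX.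
  apply/seteqP; split=> h /= Qh.
    have -> : h * f2 = - 1 * (h * 'X_[mlead g] * (f - f1)) + h * 'X_[mlead g] * f.
      by rewrite /f2; ring.
    by apply: (ideal_add iQ) => //; apply: (ideal_mull iQ).
  have -> : h * 'X_[mlead g] * f = h * 'X_[mlead g] * (f - f1) + h * f2.
    by rewrite /f2; ring.
  exact: (ideal_add iQ).
apply: nlt; apply: IH Pf2 _; rewrite /f2 mulrC.
by rewrite (perm_size (msuppMX _ _)) size_map.
Qed.

Lemma Ass_monomial Q P : upclosed Q -> Ass (supported Q) P ->
  forall g, P g -> forall m, m \in msupp g -> P 'X_[m].
Proof.
move=> upQ aP; have lc := Ass_lead_closed upQ aP.
have [iP _ _] := (prime_idealP P).1 aP.1.
move=> g; have [k] := ubnP (size (msupp g)); elim: k => // k IH in g *; rewrite ltnS => g_k.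
move=> Pg m mg; have g0 : g != 0 by rewrite -msupp_eq0; case: (msupp g) mg.
have Pl := lc _ Pg g0.
have [->//|ml] := eqVneq m (mlead g).
apply: (IH (unlead g)).
- by apply: leq_trans g_k; apply: size_unlead.
- have -> : unlead g = - 1 * (g@_(mlead g) *: 'X_[mlead g]) + g by rewrite mulN1r addrC.
  by apply: (ideal_add iP) => //; apply: (ideal_mull iP) => //; rewrite -mul_mpolyC; apply: (ideal_mull iP).
- by rewrite msupp_unlead (mem_rem_uniq _ (msupp_uniq g)) !inE ml.
Qed.

(** An associated prime contains the monomials of its elements, and with each monomial one of its
    variables, so it is some P_F. It remains to replace [f] by one of its monomials. *)
Lemma AssP Q P : upclosed Q -> Ass (supported Q) P <->
  exists F a, P = var_prime F /\ forall b, Q (a + b)%MM <-> touches F b.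
Proof.
move=> upQ; split=> [aP|[F [a [-> aF]]]]; last first.
  split; first exact: var_prime_prime.
  exists 'X_[a]; apply/seteqP; split=> f /=; rewrite mulX_supported // => Ff m /Ff;
  by move/aF.
have [iP nP1 Pp] := (prime_idealP P).1 aP.1.
have iQ := supported_ideal upQ.
have mP := Ass_monomial upQ aP.
case: aP => _ [f Pf].
pose F := [set i | `[< P 'X_i >]]%SET.
have FP i : i \in F <-> P 'X_i by rewrite inE asboolE.
have PX b : P 'X_[b] <-> touches F b.
  split=> [|[i /FP Pi bi]]; last first.
    have -> : b = (b - U_(i) + U_(i))%MM.
      by apply/mnmP=> x; rewrite mnmDE mnmBE mnm1E; case: eqP => [<-|_]; lia.
    by rewrite mpolyXD; apply: (ideal_mull iP).
  rewrite mpolyXE_id; apply: contraPP => nb.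
  apply: (big_ind (fun p => ~ P p)) => // [u v nu nv /Pp[]//|i _ Pi].
  have bi : (0 < b i)%N by rewrite lt0n; apply/eqP => bi; apply: nP1; rewrite bi expr0 in Pi.
  apply: nb; exists i => //; apply/FP; move: Pi; elim: (b i) => [//|k IH].
  by rewrite exprS => /Pp[].
have PF : P = var_prime F.
  apply/seteqP; split=> [g Pg m mg|]; first exact/PX/(mP g).
  by apply: var_prime_sub => // i /FP.
(* If every monomial of [f] had a multiplier off [F] sending it into [Q], the product of these
   multipliers would kill [f] while lying outside [P]. *)
have [a af aF] : exists2 a, a \in msupp f & forall b, Q (a + b)%MM -> touches F b.
  apply: contrapT => no_a.
  have witness a : a \in msupp f -> exists b, Q (a + b)%MM /\ ~ touches F b.
    move=> af; apply: contrapT => nb; apply: no_a; exists a => // b Qb.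
    by apply: contrapT => mb; apply: nb; exists b.
  have [b nb Qb] : exists2 b, ~ touches F b & forall a, a \in msupp f -> Q (a + b)%MM.
    elim: (msupp f) witness => [|a s IH] w.
      by exists 0%MM => // -[i _]; rewrite mnm0E.
    have [|b nb Qb] := IH; first by move=> a' a's; apply: w; rewrite inE a's orbT.
    have [b' [Qb' nb']] := w a (mem_head _ _).
    exists (b + b')%MM; first by move=> [i iF]; rewrite mnmDE addn_gt0 => /orP[bi|bi];
      [case: nb | case: nb']; exists i.
    move=> a'; rewrite inE => /orP[/eqP->|/Qb]; last by rewrite addmA; apply: upQ.
    by rewrite (addmC b) addmA; apply: upQ.
  apply: nb; apply/PX; rewrite Pf /= mulrC mulX_supported // => m mf.
  by rewrite addmC; apply: Qb.
exists F, a; split=> // b; split; first exact: aF.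
move/PX; rewrite Pf /= mulrC mulX_supported // => /(_ _ af).
by rewrite addmC.
Qed.

End MonomialIdeals.

Arguments var_prime K {n} F _.

(** * Powers of the edge ideal and its minimal primes *)

Section EdgeIdeal.

Variables (K : fieldType) (n : nat) (e : rel 'I_n).
Hypotheses (e_sym : ssrbool.symmetric e) (e_irr : irreflexive e).
Let I := edge_ideal K e.

Lemma edge_bounded_up s : upclosed (edge_bounded e s).
Proof. by move=> a b; apply: edge_bounded_le => x; rewrite mnmDE leq_addr. Qed.

Lemma edge_idealE : I = supported (edge_bounded e 1).
Proof.
apply: ideal_gen_supported; first exact: edge_bounded_up.
  move=> _ [i [j [eij ->]]]; rewrite -mpolyXD; apply/supportedX.
  by exists (0 + U_(i) + U_(j))%MM; [exists i, j, 0%MM | rewrite add0m].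
move=> a [d [i [j [d0 [eij /= -> dE]]]] da].
have -> : a = (a - (U_(i) + U_(j)) + (U_(i) + U_(j)))%MM.
  by apply/esym/submK/mnm_lepP => x; move: (da x); rewrite dE add0m.
rewrite mpolyXD; apply: (ideal_mull (ideal_gen_ideal _)).
by apply: sub_ideal_gen; exists i, j; rewrite mpolyXD.
Qed.

Lemma edge_ideal_powE s : ideal_pow I s = supported (edge_bounded e s).
Proof.
elim: s => [|s IH].
  apply/seteqP; split=> // f _ m _; exists 0%MM => // x; by rewrite mnm0E.
rewrite /ideal_pow iterS -/(ideal_pow I s) IH edge_idealE /ideal_mul.
apply: ideal_gen_supported; first exact: edge_bounded_up.
  move=> _ [u Qu [v Qv <-]] m /msuppM_le /allpairsP[[a b]] /= [/Qu au /Qv bv ->].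
  case: au bv => d1 s1 d1a [d2 s2 d2b]; exists (d1 + d2)%MM.
    by rewrite -add1n; apply: edge_sumD.
  by move=> x; rewrite !mnmDE leq_add.
move=> a [d [i [j [d1 [eij s1 dE]]]] da].
have -> : a = (a - d + ((U_(i) + U_(j)) + d1))%MM.
  rewrite (_ : (U_(i) + U_(j) + d1 = d)%MM); last first.
    by rewrite dE; apply/mnmP=> x; rewrite !mnmDE; lia.
  by apply/esym/submK/mnm_lepP.
rewrite mpolyXD; apply: (ideal_mull (ideal_gen_ideal _)).
rewrite mpolyXD; apply: sub_ideal_gen.
exists 'X_[U_(i) + U_(j)]; last exists 'X_[d1] => //; apply/supportedX; last by exists d1.
by exists (0 + U_(i) + U_(j))%MM; [exists i, j, 0%MM | rewrite add0m].
Qed.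

Lemma Ass_edge_ideal_pow s P : Ass (ideal_pow I s) P <->
  exists F a, P = var_prime K F /\ colon_prime e s F a.
Proof. by rewrite edge_ideal_powE; apply/AssP/edge_bounded_up. Qed.

Lemma edge_ideal_sub_prime P : prime_ideal P -> I `<=` P ->
  forall i j, e i j -> P 'X_i \/ P 'X_j.
Proof.
move=> /prime_idealP[_ _ Pp] IP i j eij; apply: Pp; apply: IP; apply: sub_ideal_gen.
by exists i, j.
Qed.

Lemma edge_ideal_sub_var_prime (F : {set 'I_n}) :
  I `<=` var_prime K F <-> forall i j, e i j -> (i \in F) || (j \in F).
Proof.
split=> [IF i j eij|cF].
  case: (edge_ideal_sub_prime (var_prime_prime K F) IF eij) => /var_primeX ->;
  by rewrite ?orbT.
have iF := supported_ideal K (@touches_up n F).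
apply: smallest_sub => // _ [i [j [eij ->]]].
case/orP: (cF _ _ eij) => kF; last by apply: (ideal_mull iF); apply/var_primeX.
by rewrite mulrC; apply: (ideal_mull iF); apply/var_primeX.
Qed.

(** The variables in a prime over [I] form a cover, and they already generate a prime over [I]; a
    vertex without a private edge could be dropped. *)
Lemma Min_edge_ideal P : Min I P <-> exists2 F, min_cover e F & P = var_prime K F.
Proof.
split=> [[pP IP minP]|[F [cF mF] ->]].
  have [iP _ _] := (prime_idealP P).1 pP.
  pose F := [set i | `[< P 'X_i >]]%SET.
  have FP i : i \in F <-> P 'X_i by rewrite inE asboolE.
  have cF i j : e i j -> (i \in F) || (j \in F).
    by move=> /(edge_ideal_sub_prime pP IP)[] /FP ->; rewrite ?orbT.
  have FE : var_prime K F = P.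
    apply: minP; [exact: var_prime_prime | exact/edge_ideal_sub_var_prime |].
    by apply: var_prime_sub => // i /FP.
  exists F => //; split=> // i iF; apply: contrapT => no_j.
  suff FF : var_prime K (F :\ i) = var_prime K F.
    by have := iF; rewrite -(var_prime_inj FF) !inE eqxx.
  rewrite FE; apply: minP; first exact: var_prime_prime.
    apply/edge_ideal_sub_var_prime => j k ejk; rewrite !finset.in_setD1.
    have in_nbr j' : e i j' -> j' \in F.
      by move=> eij; apply: contrapT => /negP jF; apply: no_j; exists j'.
    have [ji|ji] := eqVneq j i.
      rewrite ji in ejk *; rewrite /= in_nbr // andbT.
      by apply: contraTneq ejk => ->; rewrite e_irr.
    have [ki|ki] := eqVneq k i; last exact: cF.
    by rewrite in_nbr // -ki e_sym.
  apply: var_prime_sub => // j; by rewrite finset.in_setD1 => /andP[_ /FP].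
split; [exact: var_prime_prime | exact/edge_ideal_sub_var_prime |].
move=> Q pQ IQ QF; apply/seteqP; split=> //.
have [iQ _ _] := (prime_idealP Q).1 pQ.
apply: var_prime_sub => // i /mF[j eij jF].
by case: (edge_ideal_sub_prime pQ IQ eij) => // /QF/var_primeX; rewrite (negbTE jF).
Qed.

End EdgeIdeal.

(** * Dominating odd cycles and the equivalence *)

Lemma odd_cycle_neq0 (T : eqType) (e : rel T) c : odd_cycle e c -> c != [::].
Proof. by case/andP=> _; case: c. Qed.

(** Connectedness enters through this absence of isolated vertices. *)
Lemma ex_neighbor n (e : rel 'I_n) : irreflexive e ->
  (forall i j, connect e i j) -> (exists c, odd_cycle e c) ->
  forall l, exists y, e l y.
Proof.
move=> e_irr e_conn [[|v c] // oc] l.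
have [w _ evw] := odd_cycle_edge oc (mem_head v c).
have [lv|lv] := eqVneq l v; first by exists w; rewrite lv.
case/connectP: (e_conn l v) => -[|y p] /=; first by move=> _ vl; rewrite vl eqxx in lv.
by case/andP=> ely _ _; exists y.
Qed.

Lemma min_odd_cycle_le (T : finType) (e : rel T) (h : exists c, odd_cycle e c) c :
  odd_cycle e c -> ((min_odd_cycle h).*2.+1 <= size c)%N.
Proof.
move=> oc; rewrite /min_odd_cycle; case: ex_minnP => k _ min_k.
have sc : size c = (2 * (size c)./2 + 1)%N.
  by case/andP: oc => _ oc; rewrite -[LHS]odd_double_half oc mul2n addnC.
rewrite sc addn1 ltnS mul2n leq_double; apply: min_k.
by apply/has_odd_cycleP; exists c.
Qed.

(** An odd cycle in the interior of [F] has all its vertices and neighbours in [F], so if it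
    dominates, [F] is everything. *)
Lemma colon_prime_dominating n (e : rel 'I_n) s F a :
  ssrbool.symmetric e -> irreflexive e -> odd_cycles_dominating e ->
  colon_prime e s F a -> min_cover e F \/ F = [set: 'I_n]%SET.
Proof.
move=> e_sym e_irr dom aF.
have [FT|FT] := eqVneq F [set: 'I_n]%SET; [by right | left].
apply: min_cover_interior => [i j|]; first exact: colon_prime_cover aF.
apply/eqP; apply: contraNT FT => /finset.set0Pn[i0 i0R].
have [c oc _] := odd_cycle_in_interior e_sym e_irr aF i0R.
have cR i : i \in c -> i \in interior e F.
  by case/(odd_cycle_edge oc) => j _ /= /and3P[].
have {}oc : odd_cycle e c by apply: sub_odd_cycle oc => i j /= /and3P[].
apply/eqP/setP=> l; rewrite finset.in_setT; have : l \in [set: 'I_n]%SET by rewrite finset.in_setT.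
rewrite -(dom c oc) !inE => /orP[/cR|/existsP[i /andP[]]]; first by rewrite inE => /andP[].
by rewrite inE => /cR; rewrite inE => /andP[_ /forallP/(_ l)/implyP]; apply.
Qed.

(** Every vertex is interior to the full set, so some odd cycle is shorter than 2s. *)
Lemma colon_prime_setT_gt n (e : rel 'I_n) s a (h : exists c, odd_cycle e c) :
  ssrbool.symmetric e -> irreflexive e ->
  colon_prime e s [set: 'I_n]%SET a -> (min_odd_cycle h < s)%N.
Proof.
move=> e_sym e_irr aT; have [[|i0 c0] oc0] := h; first by [].
have i0R : i0 \in interior e [set: 'I_n]%SET.
  by rewrite inE finset.in_setT; apply/forallP=> j; rewrite finset.in_setT implybT.
have [c oc lt_c] := odd_cycle_in_interior e_sym e_irr aT i0R.
have {}oc : odd_cycle e c by apply: sub_odd_cycle oc => i j /= /and3P[].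
by have := leq_ltn_trans (min_odd_cycle_le h oc) lt_c; lia.
Qed.

Theorem theorem1p3 (K : fieldType) (n : nat) (e : rel 'I_n)
    (e_sym : ssrbool.symmetric e) (e_irr : irreflexive e)
    (e_conn : forall i j : 'I_n, connect e i j)
    (odd_ex : exists c : seq 'I_n, odd_cycle e c) :
  let I : set {mpoly K[n]} := edge_ideal K e in
  let mm : set {mpoly K[n]} := max_ideal K n in
  let k : nat := min_odd_cycle odd_ex in
  (Ass_infty I = Min I `|` [set mm] <-> odd_cycles_dominating e) /\
  (odd_cycles_dominating e ->
    (forall m : nat, (1 <= m <= k)%N -> Ass (ideal_pow I m) = Min I) /\
    (forall m : nat, (k + 1 <= m)%N ->
      Ass (ideal_pow I m) = Min I `|` [set mm])).
Proof.
move=> I mm k; have nbr := ex_neighbor e_irr e_conn odd_ex.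
have [c0 oc0 sc0] : exists2 c, odd_cycle e c & size c = (2 * k + 1)%N.
  apply/has_odd_cycleP; rewrite /k /min_odd_cycle; by case: ex_minnP.
have mmE : mm = var_prime K [set: 'I_n]%SET by rewrite var_prime_setT.
have MinI := @Min_edge_ideal K n e e_sym e_irr.
have AssI := @Ass_edge_ideal_pow K n e.
have persist s F a v : colon_prime e s F a -> v \notin F ->
    exists a', colon_prime e s.+1 F a'.
  move=> aF vF; have [y evy] := nbr v.
  by exists (a + U_(v) + U_(y))%MM; apply: colon_primeS.
have Min_sub s : (0 < s)%N -> Min I `<=` Ass (ideal_pow I s).
  move=> s_gt0 P /MinI[F mF ->]; apply/AssI.
  suff [a aF] : exists a, colon_prime e s F a by exists F, a.
  (* A minimal cover is proper: a cycle vertex lies outside it or has a neighbour outside. *)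
  have [v vF] : exists v, v \notin F.
    case: (c0) oc0 => // v c _; have [vF|vF] := boolP (v \in F); last by exists v.
    by have [w _ wF] := mF.2 v vF; exists w.
  case: s s_gt0 => // s _; elim: s => [|s [a aF]]; last exact: persist aF vF.
  by exists (\sum_(l | l \notin F) U_(l))%MM; apply: min_cover_colon_prime.
have Ass_sub s P : odd_cycles_dominating e -> Ass (ideal_pow I s) P ->
    Min I P \/ P = mm /\ (k < s)%N.
  move=> dom /AssI[F [a [-> aF]]].
  have [mF|FT] := colon_prime_dominating e_sym e_irr dom aF.
    by left; apply/MinI; exists F.
  by right; rewrite FT in aF *; split=> //; apply: colon_prime_setT_gt aF.
have mm_Ass s : odd_cycles_dominating e -> (k < s)%N -> Ass (ideal_pow I s) mm.
  move=> dom ks; apply/AssI; exists [set: 'I_n]%SET.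
  have [|a aT] := dominating_colon_prime e_sym oc0 (odd_cycle_neq0 oc0) (dom _ oc0) (s := s).
    by rewrite sc0; lia.
  by exists a.
split; last first.
  move=> dom; split=> m.
    move=> /andP[m_gt0 mk]; apply/seteqP; split; last exact: Min_sub.
    by move=> P /(Ass_sub _ _ dom)[//|[_]]; rewrite ltnNge mk.
  rewrite addn1 => km; apply/seteqP; split=> P.
    by move/(Ass_sub _ _ dom) => [|[]]; [left | right].
  by case=> [|->]; [apply: Min_sub; apply: leq_trans km | exact: mm_Ass].
split=> [AI c oc|dom].
  (* A cycle not dominating [v] yields a prime that is not minimal and omits x_v, hence differs from
     [mm]; an edge at [v] makes it persist. *)
  apply/eqP; apply: contraT; rewrite finset.eqEsubset finset.subsetT /= => /fintype.subsetPn[v _ vN].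
  have [F [a [s [vF aF nmF]]]] :=
    nondominating_colon_prime e_sym e_irr oc (odd_cycle_neq0 oc) vN.
  have : Ass_infty I (var_prime K F).
    split; last first.
      exists s; first exact: colon_prime_gt0 aF.
      by apply/AssI; exists F, a.
    split; [exact: var_prime_monomial | exact: var_prime_prime | |].
      by apply/edge_ideal_sub_var_prime => i j; apply: colon_prime_cover aF.
    move=> j _ /AssI[F' [a' [/var_prime_inj <- aF']]]; apply/AssI.
    by have [a2 aF2] := persist _ _ _ _ aF' vF; exists F, a2.
  rewrite AI => -[/MinI[F' mF' /var_prime_inj FF]|]; first by case: nmF; rewrite FF.
  by rewrite /= mmE => /var_prime_inj FT; rewrite FT finset.in_setT in vF.
apply/seteqP; split=> P.
  by case=> _ [s _ /(Ass_sub _ _ dom)[|[]]]; [left | right].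
case=> [mP|->]; split.
- have /MinI[F mF PE] := mP; split.
  + by rewrite PE; apply: var_prime_monomial.
  + by case: mP.
  + by case: mP.
  + by move=> j _ _; apply: Min_sub mP.
- by exists 1%N => //; apply: Min_sub mP.
- split; rewrite ?mmE; [exact: var_prime_monomial | exact: var_prime_prime | |].
    by apply/edge_ideal_sub_var_prime => i j _; rewrite finset.in_setT.
  (* If [mm] is associated to the [j]-th power then [k < j], and every power beyond [k] has [mm]. *)
  move=> j _ /AssI[F' [a' [/var_prime_inj <- aF']]]; rewrite -mmE; apply: mm_Ass => //.
  by apply: leqW; apply: colon_prime_setT_gt aF'.
by exists k.+1 => //; apply: mm_Ass.
Qed.
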